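(* Let $\mathscr A$ be a strongly subconvex $L^p$-set with $p>1$. Let $\mathscr B,\mathscr C\subseteq\mathbb N$ with $\mathscr B\subset\mathscr A$ and $\mathscr C\subset\mathbb N\setminus\mathscr A$ satisfy $B(N)+C(N)\ll N^{2-2/p}$ for all large $N$. Then $\mathscr A'=(\mathscr A\setminus\mathscr B)\cup\mathscr C$ is also a strongly subconvex $L^p$-set.
   Context: For $\mathscr D\subseteq\mathbb N$ write $\mathscr D(N)=\mathscr D\cap[1,N]$, $D(N)=\mathrm{card}(\mathscr D(N))$ (so $B(N),C(N)$ are the counting functions of $\mathscr B,\mathscr C$), $e(z)=e^{2\pi iz}$ and $I_p(N;\mathscr D)=\int_0^1|\sum_{n\in\mathscr D(N)}e(n\alpha)|^p\,d\alpha$. A non-empty $\mathscr D\subseteq\mathbb N$ is a strongly subconvex $L^p$-set if $0<p<2$ and for all $N$ sufficiently large in terms of $p$, $I_p(N;\mathscr D)\ll N^{-1}D(N)^p$ with implied constant independent of $N$. *)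

(* Defs.v *)
From mathcomp Require Import all_boot all_order all_algebra.
From mathcomp Require Import finmap complex.
From mathcomp Require Import all_classical all_reals all_analysis.

Set Implicit Arguments.
Unset Strict Implicit.
Unset Printing Implicit Defensive.

Import Order.TTheory GRing.Theory Num.Theory.
Import numFieldNormedType.Exports.

Local Open Scope classical_set_scope.
Local Open Scope ring_scope.

(* Sets of natural numbers are sets of positive integers: the element 0 is
   invisible to every truncation D(N), so that without this restriction {0}
   would vacuously qualify as a subconvex set. *)
Definition positive_nat : set nat := [set n | (0 < n)%N].

Definition trunc (D : set nat) (N : nat) : {fset nat} :=
  [fset n in iota 1 N | n \in D]%fset.

Definition card_trunc (D : set nat) (N : nat) : nat := #|` trunc D N|.

Definition expi {R : realType} (x : R) : R[i] :=
  (cos (2 * pi * x) +i* sin (2 * pi * x))%C.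

Definition expsum {R : realType} (D : set nat) (N : nat) (alpha : R) : R[i] :=
  \sum_(n <- trunc D N) expi (n%:R * alpha).

(* The norm of R[i] takes values in R[i]; [Normc.normc] is the R-valued
   modulus. *)
Definition mean_value {R : realType} (p : R) (D : set nat) (N : nat) : R :=
  \int[@lebesgue_measure R]_(alpha in `[0, 1])
    (Normc.normc (expsum D N alpha) `^ p).

(* Vinogradov's notation f(N) << g(N) for all sufficiently large N. *)
Definition vinogradov {R : realType} (f g : nat -> R) : Prop :=
  exists2 K : R, 0 < K & \forall N \near \oo, `|f N| <= K * g N.

Definition strongly_subconvex {R : realType} (p : R) (D : set nat) : Prop :=
  [/\ D `<=` positive_nat, D !=set0, 0 < p < 2 &
      vinogradov (mean_value p D)
        (fun N => N%:R^-1 * (card_trunc D N)%:R `^ p)].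

(* Main.v *)
(* Since |f|^2 <= D(N)^(2-p) |f|^p for the exponential sum f over D(N),
   Parseval gives D(N) <= D(N)^(2-p) I_p(N; D), so a subconvex set has positive
   lower density. The sum over A' differs from the sum over A by the sum h over
   C minus the sum over B, and t^p <= l^p + l^(p-2) t^2 with l = N^(1-1/p)
   turns Parseval for h into a bound of order N^(p-1) for the integral of |h|^p.
   This is N^(-1) N^p, and N = O(A'(N)) because B(N) = o(N). *)
Require Import Defs.
From mathcomp Require Import all_boot all_order all_algebra.
From mathcomp Require Import finmap complex.
From mathcomp Require Import all_classical all_reals all_analysis.
From mathcomp Require Import measurable_realfun ring lra.

Set Implicit Arguments.
Unset Strict Implicit.
Unset Printing Implicit Defensive.

Import Order.TTheory GRing.Theory Num.Theory.
Import numFieldNormedType.Exports.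

Local Open Scope classical_set_scope.
Local Open Scope ring_scope.

Local Notation mu := lebesgue_measure.

(** * Integrals over the unit interval and orthogonality of the cosines *)

Lemma integrable01_continuous (R : realType) (f : R -> R) :
  continuous f -> (@lebesgue_measure R).-integrable `[0, 1] (EFin \o f).
Proof.
move=> cf; apply: continuous_compact_integrable; first exact: segment_compact.
by apply: continuous_in_subspaceT => x _; exact: cf.
Qed.

Lemma Rintegral01_cst (R : realType) (r : R) : \int[mu]_(x in `[0, 1]) r = r.
Proof.
by rewrite Rintegral_cst//= lebesgue_measure_itv/= lte_fin ltr01 oppr0 adde0 mulr1.
Qed.

Lemma continuous_cosM (R : realType) (a : R) :
  continuous (fun x : R => cos (a * x)).
Proof.
move=> x; apply: continuous_comp; last exact: continuous_cos.
by apply: cvgM; [exact: cvg_cst | exact: cvg_id].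
Qed.

Lemma continuous_sinM (R : realType) (a : R) :
  continuous (fun x : R => sin (a * x)).
Proof.
move=> x; apply: continuous_comp; last exact: continuous_sin.
by apply: cvgM; [exact: cvg_cst | exact: cvg_id].
Qed.

Lemma sin_int2pi (R : realType) (k : int) : sin (2 * pi * k%:~R : R) = 0.
Proof.
have nat2pi n : sin (2 * pi * n%:R : R) = 0.
  elim: n => [|n IH]; first by rewrite mulr0 sin0.
  have -> : 2 * pi * n.+1%:R = 2 * pi * n%:R + pi *+ 2 :> R.
    by rewrite -natr1 -mulr_natr; ring.
  by rewrite sinD2pi.
case: k => n; first exact: nat2pi.
by rewrite NegzE intrN mulrN sinN nat2pi oppr0.
Qed.

(** For nonzero [k] the antiderivative [a^-1 * sin (a * x)] vanishes at both endpoints, [a] being an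
    integer multiple of 2 pi. This is the orthogonality behind Parseval. *)
Lemma Rintegral01_cos (R : realType) (k : int) :
  \int[mu]_(x in `[0, 1]) cos (2 * pi * k%:~R * x : R) = (k == 0)%:R.
Proof.
have [->|k0] := eqVneq k 0.
  under eq_Rintegral do rewrite mulr0z mulr0 mul0r cos0.
  exact: Rintegral01_cst.
set a := 2 * pi * k%:~R : R.
have a0 : a != 0 by rewrite !mulf_neq0 ?intr_eq0 // lt0r_neq0 ?pi_gt0.
pose F (x : R) : R := a^-1 * sin (a * x).
have dF (x : R) : is_derive x 1 F (cos (a * x)).
  apply: is_derive_eq.
  by rewrite /GRing.scale/=; field.
have cF : continuous F.
  by move=> x; apply: cvgM; [exact: cvg_cst | exact: continuous_sinM].
rewrite /Rintegral (@continuous_FTC2 _ _ F) //.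
- by rewrite /F mulr0 sin0 mulr1 sin_int2pi !mulr0 -EFinB subrr.
- apply: continuous_in_subspaceT => x _; exact: continuous_cosM.
- split.
  + by move=> x _; apply: ex_derive.
  + exact/cvg_at_right_filter/cF.
  + exact/cvg_at_left_filter/cF.
- by move=> x _; rewrite derive1E; apply: derive_val.
Qed.

Lemma continuous_bigsum (R : realType) (I : Type) (s : seq I)
  (f : I -> R -> R) :
  (forall i, continuous (f i)) -> continuous (fun x => \sum_(i <- s) f i x).
Proof.
by move=> cf; apply: continuous_big => [|i _]; [exact: add_continuous|exact: cf].
Qed.

Lemma Rintegral01_sum (R : realType) (I : Type) (s : seq I) (f : I -> R -> R) :
  (forall i, continuous (f i)) ->
  \int[mu]_(x in `[0, 1]) (\sum_(i <- s) f i x)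
    = \sum_(i <- s) \int[mu]_(x in `[0, 1]) f i x.
Proof.
move=> cf; elim: s => [|i s IH].
  under eq_Rintegral do rewrite big_nil.
  by rewrite big_nil Rintegral01_cst.
under eq_Rintegral do rewrite big_cons.
rewrite big_cons -IH RintegralD //; first exact: integrable01_continuous.
apply: integrable01_continuous => x.
by apply: continuous_bigsum.
Qed.

(** * Trigonometric sums with real weights, and Parseval's identity *)

Definition trigsum (R : realType) (s : seq nat) (c : nat -> R) (x : R) : R[i] :=
  ((\sum_(n <- s) c n * cos (2 * pi * (n%:R * x))) +i*
   (\sum_(n <- s) c n * sin (2 * pi * (n%:R * x))))%C.

(** As weights over one common range, sets can be added and subtracted, so that C minus B makes
    sense as a single trigonometric sum. *)
Definition indic_weight (R : realType) (D : set nat) (n : nat) : R :=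
  (n \in D)%:R.

Lemma trigsumD (R : realType) (s : seq nat) (c d : nat -> R) (x : R) :
  trigsum s (fun n => c n + d n) x = trigsum s c x + trigsum s d x.
Proof.
have wD (f : nat -> R) : \sum_(n <- s) (c n + d n) * f n =
    \sum_(n <- s) c n * f n + \sum_(n <- s) d n * f n.
  by rewrite -big_split; apply: eq_bigr => n _; rewrite mulrDl.
by rewrite /trigsum !wD.
Qed.

(** The squared real and imaginary parts expand into double sums whose cos cos + sin sin terms
    collapse by the subtraction formula. Only integer frequencies remain. *)
Lemma sqr_normc_trigsum (R : realType) (s : seq nat) (c : nat -> R) (x : R) :
  Normc.normc (trigsum s c x) ^+ 2 =
  \sum_(m <- s) \sum_(n <- s)
    c m * c n * cos (2 * pi * (m%:Z - n%:Z)%:~R * x).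
Proof.
rewrite /trigsum /= sqr_sqrtr ?addr_ge0 ?sqr_ge0// !expr2 !big_distrlr /=.
rewrite -big_split; apply: eq_bigr => m _; rewrite -big_split /=.
apply: eq_bigr => n _; rewrite intrB /= mulrBr mulrBl -!mulrA cosB.
by rewrite !pmulrn; ring.
Qed.

Lemma continuous_sqr_normc_trigsum (R : realType) (s : seq nat) (c : nat -> R) :
  continuous (fun x : R => Normc.normc (trigsum s c x) ^+ 2).
Proof.
under eq_fun do rewrite sqr_normc_trigsum.
apply: continuous_bigsum => m; apply: continuous_bigsum => n x.
by apply: cvgM; [exact: cvg_cst | exact: continuous_cosM].
Qed.

Lemma normc_ge0 (R : realType) (z : R[i]) : 0 <= Normc.normc z.
Proof. by case: z => a b; exact: sqrtr_ge0. Qed.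

(** Lets the modulus inherit continuity from its square, a finite sum of cosines. *)
Lemma normc_sqrtK (R : realType) (z : R[i]) :
  Normc.normc z = Num.sqrt (Normc.normc z ^+ 2).
Proof. by rewrite sqrtr_sqr ger0_norm ?normc_ge0. Qed.

Lemma continuous_normc_trigsum (R : realType) (s : seq nat) (c : nat -> R) :
  continuous (fun x : R => Normc.normc (trigsum s c x)).
Proof.
under eq_fun do rewrite normc_sqrtK.
move=> x; apply: continuous_comp; first exact: continuous_sqr_normc_trigsum.
exact: sqrt_continuous.
Qed.

(** Termwise integration of the cosine expansion leaves only zero frequencies; as [s] has no
    repetitions, these form exactly the diagonal. *)
Lemma trigsum_parseval (R : realType) (s : seq nat) (c : nat -> R) :
  uniq s ->
  \int[mu]_(x in `[0, 1]) (Normc.normc (trigsum s c x) ^+ 2)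
    = \sum_(n <- s) c n ^+ 2.
Proof.
move=> us; under eq_Rintegral do rewrite sqr_normc_trigsum.
have ct (m n : nat) : continuous
    (fun x : R => c m * c n * cos (2 * pi * (m%:Z - n%:Z)%:~R * x)).
  by move=> x; apply: cvgM; [exact: cvg_cst | exact: continuous_cosM].
rewrite Rintegral01_sum; last by move=> m; exact: continuous_bigsum.
apply: eq_big_seq => m ms; rewrite Rintegral01_sum//.
rewrite (bigD1_seq m) //= big1 ?addr0 => [|n nm].
  rewrite RintegralZl//; last exact/integrable01_continuous/continuous_cosM.
  by rewrite Rintegral01_cos subrr eqxx mulr1 expr2.
rewrite RintegralZl//; last exact/integrable01_continuous/continuous_cosM.
by rewrite Rintegral01_cos subr_eq0 eqz_nat eq_sym (negbTE nm) mulr0.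
Qed.

(** * Truncations and exponential sums as weighted sums over [iota 1 N] *)

Lemma mem_trunc (D : set nat) (N n : nat) :
  (n \in trunc D N) = (n \in iota 1 N) && (n \in D).
Proof. by rewrite in_fset. Qed.

Lemma big_trunc (V : zmodType) (D : set nat) (N : nat) (F : nat -> V) :
  \sum_(n <- trunc D N) F n = \sum_(n <- iota 1 N | n \in D) F n.
Proof.
rewrite -[RHS]big_filter; apply: perm_big; apply: uniq_perm.
- exact: fset_uniq.
- exact/filter_uniq/iota_uniq.
- by move=> n; rewrite mem_trunc mem_filter andbC.
Qed.

Lemma expsumE (R : realType) (D : set nat) (N : nat) (x : R) :
  expsum D N x = trigsum (iota 1 N) (indic_weight R D) x.
Proof.
rewrite /expsum big_trunc /trigsum /indic_weight.
elim: (iota 1 N) => [|n s IH]; first by rewrite !big_nil.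
rewrite !big_cons; case: ifP => _; last by rewrite IH !mul0r !add0r.
by rewrite IH !mul1r /expi.
Qed.

Lemma card_truncE (R : realType) (D : set nat) (N : nat) :
  (card_trunc D N)%:R = \sum_(n <- iota 1 N) indic_weight R D n.
Proof.
rewrite /card_trunc -sum1_size natr_sum big_trunc big_mkcond.
by apply: eq_bigr => n _; rewrite /indic_weight; case: (n \in D).
Qed.

(** * Bounds for p-th power means *)

Lemma powR_le_split (R : realType) (p l t : R) :
  0 < p < 2 -> 0 < l -> 0 <= t ->
  t `^ p <= l `^ p + l `^ (p - 2) * t ^+ 2.
Proof.
move=> /andP[p0 p2] l0 t0; have [tl|lt] := leP t l.
  rewrite (@le_trans _ _ (l `^ p))//.
    by rewrite ge0_ler_powR// ?nnegrE ltW.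
  by rewrite lerDl mulr_ge0 ?powR_ge0 ?sqr_ge0.
(* For t > l the second term dominates: p - 2 is negative, so t^(p-2) is at most l^(p-2). *)
have t_gt0 : 0 < t := lt_trans l0 lt.
have -> : t `^ p = t `^ (p - 2) * t ^+ 2.
  by rewrite -powR_mulrn// -powRD ?subrK// gt_eqF ?implybT.
rewrite (@le_trans _ _ (l `^ (p - 2) * t ^+ 2))//; last first.
  by rewrite lerDr powR_ge0.
rewrite ler_wpM2r ?sqr_ge0// -[p - 2]opprB !powRN lef_pV2 ?posrE ?powR_gt0//.
by rewrite ge0_ler_powR// ?nnegrE ?(ltW l0) ?(ltW lt)// subr_ge0 ltW.
Qed.

(** The sum is at most twice the larger term; no convexity is involved, so every positive p is
    covered. *)
Lemma powR_addr_le (R : realType) (p x y : R) : 0 < p -> 0 <= x -> 0 <= y ->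
  (x + y) `^ p <= 2 `^ p * (x `^ p + y `^ p).
Proof.
move=> p0 x0 y0; wlog xy : x y x0 y0 / x <= y => [H|].
  have [xy|/ltW yx] := leP x y; first exact: H.
  by rewrite addrC [X in _ * X]addrC; exact: H.
rewrite (@le_trans _ _ ((2 * y) `^ p))//.
  by rewrite ge0_ler_powR ?nnegrE ?addr_ge0 ?mulr_ge0// ?(ltW p0)//; lra.
by rewrite powRM// ler_wpM2l ?powR_ge0// lerDr powR_ge0.
Qed.

(** The splitting inequality at l = 1 gives the continuous majorant 1 + |f|^2. *)
Lemma integrable_normc_powR (R : realType) (s : seq nat) (c : nat -> R)
  (p : R) :
  0 < p < 2 -> (@lebesgue_measure R).-integrable `[0, 1]
    (EFin \o (fun x : R => Normc.normc (trigsum s c x) `^ p)).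
Proof.
move=> p02; have g_int : (@lebesgue_measure R).-integrable `[0, 1]
    (EFin \o (fun x : R => 1 + Normc.normc (trigsum s c x) ^+ 2)).
  apply: integrable01_continuous => x; apply: cvgD; first exact: cvg_cst.
  exact: continuous_sqr_normc_trigsum.
apply: (le_integrable _ _ _ g_int) => //.
  apply/measurable_EFinP; apply: (measurableT_comp (measurable_powR p)).
  apply: measurable_funTS; apply: continuous_measurable_fun.
  exact: continuous_normc_trigsum.
move=> x _; rewrite lee_fin !ger0_norm ?powR_ge0 ?addr_ge0 ?sqr_ge0//.
have := powR_le_split p02 ltr01 (normc_ge0 (trigsum s c x)).
by rewrite !powR1 mul1r.
Qed.

(** The splitting inequality is integrated and Parseval applied; [l] stays free, to be chosen later
    in terms of [N]. *)
Lemma Lp_trigsum_le (R : realType) (s : seq nat) (c : nat -> R) (p l : R) :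
  uniq s -> 0 < p < 2 -> 0 < l ->
  \int[mu]_(x in `[0, 1]) (Normc.normc (trigsum s c x) `^ p)
    <= l `^ p + l `^ (p - 2) * \sum_(n <- s) c n ^+ 2.
Proof.
move=> us p02 l0; rewrite -trigsum_parseval//.
have sq_int := integrable01_continuous (@continuous_sqr_normc_trigsum R s c).
have lsq_cont : continuous
    (fun x : R => l `^ (p - 2) * Normc.normc (trigsum s c x) ^+ 2).
  by move=> x; apply: cvgM; [exact: cvg_cst|exact: continuous_sqr_normc_trigsum].
have cst_cont : continuous (fun _ : R => l `^ p) by move=> x; exact: cvg_cst.
rewrite -(Rintegral01_cst (l `^ p)) -RintegralZl// -RintegralD//;
  [|exact: integrable01_continuous|exact: integrable01_continuous].
apply: le_Rintegral => //; first exact: integrable_normc_powR.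
- apply: integrable01_continuous => x; apply: cvgD; first exact: cvg_cst.
  exact: lsq_cont.
- by move=> x _; exact: powR_le_split (normc_ge0 _).
Qed.

Lemma Lp_trigsumD (R : realType) (s : seq nat) (c d : nat -> R) (p : R) :
  0 < p < 2 ->
  \int[mu]_(x in `[0, 1]) (Normc.normc (trigsum s (fun n => c n + d n) x) `^ p)
  <= 2 `^ p * (\int[mu]_(x in `[0, 1]) (Normc.normc (trigsum s c x) `^ p)
             + \int[mu]_(x in `[0, 1]) (Normc.normc (trigsum s d x) `^ p)).
Proof.
move=> p02; have [p0 _] := andP p02.
have ci := integrable_normc_powR s c p02.
have di := integrable_normc_powR s d p02.
have cdi : (@lebesgue_measure R).-integrable `[0, 1] (EFin \o (fun x : R =>
    Normc.normc (trigsum s c x) `^ p + Normc.normc (trigsum s d x) `^ p)).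
  by apply: eq_integrable (integrableD _ ci di).
rewrite -RintegralD// -RintegralZl//; apply: le_Rintegral => //.
- exact: integrable_normc_powR.
- by apply: eq_integrable (integrableZl _ (2 `^ p) cdi).
- move=> x _; rewrite trigsumD.
  apply: le_trans (powR_addr_le p0 (normc_ge0 _) (normc_ge0 _)).
  by rewrite ge0_ler_powR ?nnegrE ?addr_ge0 ?normc_ge0 ?(ltW p0)// le_normcD.
Qed.

(** After squaring, the two double sums compare term by term, since each cosine has absolute value
    at most 1. *)
Lemma normc_trigsum_le (R : realType) (s : seq nat) (c : nat -> R) (x : R) :
  Normc.normc (trigsum s c x) <= \sum_(n <- s) `|c n|.
Proof.
rewrite -(@ler_pXn2r _ 2) ?nnegrE ?normc_ge0 ?sumr_ge0//.
rewrite sqr_normc_trigsum expr2 big_distrlr /=.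
apply: ler_sum => m _; apply: ler_sum => n _.
rewrite -normrM (le_trans (ler_norm _))// [leLHS]normrM ler_piMr//.
by rewrite ler_norml cos_geN1 cos_le1.
Qed.

(** * Positive lower density of subconvex sets *)

Lemma mean_valueE (R : realType) (p : R) (D : set nat) (N : nat) :
  mean_value p D N = \int[mu]_(x in `[0, 1])
    (Normc.normc (trigsum (iota 1 N) (indic_weight R D) x) `^ p).
Proof. by rewrite /mean_value; under eq_Rintegral do rewrite expsumE. Qed.

Lemma card_trunc_le_mean_value (R : realType) (p : R) (D : set nat) (N : nat) :
  0 < p < 2 ->
  (card_trunc D N)%:R <= (card_trunc D N)%:R `^ (2 - p) * mean_value p D N.
Proof.
move=> p02; have /andP[p0 p2] := p02.
set d := (card_trunc D N)%:R : R.
have dE : d = \sum_(n <- iota 1 N) indic_weight R D n ^+ 2.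
  rewrite /d card_truncE; apply: eq_bigr => n _.
  by rewrite /indic_weight; case: (n \in D); rewrite ?expr1n ?expr0n.
rewrite {1}dE -trigsum_parseval ?iota_uniq// mean_valueE.
have pint := integrable_normc_powR (iota 1 N) (indic_weight R D) p02.
rewrite -RintegralZl//; apply: le_Rintegral => //.
- exact/integrable01_continuous/continuous_sqr_normc_trigsum.
- by apply: eq_integrable (integrableZl _ (d `^ (2 - p)) pint).
- move=> x _; set t := Normc.normc _.
  have t0 : 0 <= t by exact: normc_ge0.
  (* The exponents add up to 2, which is nonzero, so the power law also holds at t = 0. *)
  have -> : t ^+ 2 = t `^ (2 - p) * t `^ p.
    by rewrite -powR_mulrn// -powRD ?subrK// pnatr_eq0.
  rewrite ler_wpM2r ?powR_ge0// ge0_ler_powR ?nnegrE ?subr_ge0 ?(ltW p2)//.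
  rewrite (le_trans (normc_trigsum_le _ _ _))// /d card_truncE.
  by apply: ler_sum => n _; rewrite ger0_norm.
Qed.

(** Inserting the subconvex bound into the Parseval inequality gives d <= K d^2 / N with d = D(N).
    Once [N] reaches some element of [D], d is positive and cancels, so the same [K] serves. *)
Lemma subconvex_positive_density (R : realType) (p : R) (D : set nat) :
  strongly_subconvex p D ->
  exists2 K : R, 0 < K & \forall N \near \oo, N%:R <= K * (card_trunc D N)%:R.
Proof.
move=> [Dpos [d0 Dd0] p02 [K K0 HK]]; exists K => //.
near=> N.
have d0N : (d0 <= N)%N by near: N; exact: nbhs_infty_ge.
have IK : `|mean_value p D N| <= K * (N%:R^-1 * (card_trunc D N)%:R `^ p).
  by near: N; exact: HK.
have d0_gt0 : (0 < d0)%N := Dpos _ Dd0.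
have N0 : 0 < N%:R :> R by rewrite ltr0n (leq_trans d0_gt0).
set d := (card_trunc D N)%:R : R.
have d_gt0 : 0 < d.
  rewrite ltr0n cardfs_gt0; apply/fset0Pn; exists d0.
  by rewrite mem_trunc mem_iota d0_gt0 add1n ltnS d0N; exact/mem_set.
have dle : d <= d `^ (2 - p) * (K * (N%:R^-1 * d `^ p)).
  rewrite (le_trans (card_trunc_le_mean_value _ _ p02))//.
  by rewrite ler_wpM2l ?powR_ge0// (le_trans (ler_norm _)).
have dd : d `^ (2 - p) * d `^ p = d * d.
  by rewrite -powRD ?subrK ?powR_mulrn ?expr2 ?ltW// pnatr_eq0.
have {dle} : d * N%:R <= d * (K * d).
  rewrite -ler_pdivlMr//; apply: (le_trans dle); rewrite le_eqVlt.
  apply/orP; left; apply/eqP.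
  transitivity (d `^ (2 - p) * d `^ p * K / N%:R); first by ring.
  by rewrite dd; ring.
by rewrite ler_pM2l.
Unshelve. all: by end_near.
Qed.

(** * Stability under a sparse perturbation *)

Lemma near_powR_ge (R : realType) (e M : R) :
  0 < e -> \forall N \near \oo, M <= N%:R `^ e.
Proof.
move=> e0; near=> N.
(* Replacing [M] by its nonnegative part allows taking the root of order [e]; any [N] above that
   root will do. *)
have M0 : 0 <= Num.max M 0 by rewrite le_max lexx orbT.
rewrite (@le_trans _ _ (Num.max M 0))//; first by rewrite le_max lexx.
rewrite -[leLHS]powRr1// -[X in _ `^ X](mulVf (lt0r_neq0 e0)) powRrM.
rewrite ge0_ler_powR ?nnegrE ?powR_ge0 ?(ltW e0)//.
by near: N; exact: nbhs_infty_ger.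
Unshelve. all: by end_near.
Qed.

Theorem theorem3p5 (R : realType) (p : R) (A B C : set nat)
  (hA : strongly_subconvex p A) (hp : 1 < p)
  (hB : B `<=` A) (hC : C `<=` positive_nat `\` A)
  (hBC : vinogradov
           (fun N => (card_trunc B N)%:R + (card_trunc C N)%:R : R)
           (fun N => N%:R `^ (2 - 2 / p))) :
  strongly_subconvex p ((A `\` B) `|` C).
Proof.
have [K0 K0_gt0 denseA] := subconvex_positive_density hA.
have [posA _ p02 [K1 K1_gt0 HA]] := hA.
have [K2 K2_gt0 HBC] := hBC.
have /andP[p0 p2] := p02.
have p_neq0 := lt0r_neq0 p0.
pose iA := indic_weight R A; pose iB := indic_weight R B.
pose iC := indic_weight R C; pose A' := (A `\` B) `|` C.
(* Since B lies inside A and C outside, the indicator of A' is that of A plus the perturbation C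
   minus B. *)
have wA' n : indic_weight R A' n = iA n + (iC n - iB n).
  rewrite /iA /iB /iC /indic_weight /A' in_setU in_setD.
  have [/set_mem Cn|_] := boolP (n \in C).
    have [_ nA] := hC _ Cn.
    rewrite (memNset nA) (memNset (fun Bn => nA (hB _ Bn))) /=; lra.
  have [/set_mem Bn|_] := boolP (n \in B).
    by rewrite (mem_set (hB _ Bn)) /=; lra.
  by rewrite andbT orbF; lra.
(* B and C are disjoint, so the perturbation takes values in {-1, 0, 1}; its Parseval sum is
   therefore B(N) + C(N). *)
have sqrBC n : (iC n - iB n) ^+ 2 = iB n + iC n.
  rewrite /iB /iC /indic_weight.
  have [/set_mem Cn|_] := boolP (n \in C); last first.
    by case: (n \in B) => /=; lra.
  have [_ nA] := hC _ Cn.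
  by rewrite (memNset (fun Bn => nA (hB _ Bn))) /=; lra.
have card_A' N : (card_trunc A N)%:R <=
    (card_trunc A' N)%:R + (card_trunc B N)%:R :> R.
  rewrite !card_truncE -big_split; apply: ler_sum => n _ /=.
  rewrite wA'; suff : 0 <= iC n by rewrite /iA /iB; lra.
  exact: ler0n.
(* This is 2 - 2/p < 1, a consequence of p < 2, and makes B(N) of smaller order than [N]. *)
have e_gt0 : 0 < 2 / p - 1 by rewrite subr_gt0 ltr_pdivlMr// mul1r.
(* N <= K0 A(N) <= K0 A'(N) + K0 B(N), and the last term is eventually at most N/2; absorbing it
   doubles the constant. *)
have dense : \forall N \near \oo, N%:R <= 2 * K0 * (card_trunc A' N)%:R :> R.
  near=> N.
  have N0 : 0 < N%:R :> R by rewrite ltr0n; near: N; exact: nbhs_infty_gt.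
  have NA : N%:R <= K0 * (card_trunc A N)%:R by near: N; exact: denseA.
  have BCN : `|(card_trunc B N)%:R + (card_trunc C N)%:R| <=
      K2 * N%:R `^ (2 - 2 / p) by near: N; exact: HBC.
  have MN : 2 * K0 * K2 <= N%:R `^ (2 / p - 1) by near: N; exact: near_powR_ge.
  have BN : 2 * K0 * (card_trunc B N)%:R <= N%:R.
    have -> : N%:R = N%:R `^ (2 / p - 1) * N%:R `^ (2 - 2 / p) :> R.
      rewrite -powRD ?(gt_eqF N0) ?implybT//.
      by rewrite (_ : 2 / p - 1 + (2 - 2 / p) = 1) ?powRr1 ?ltW//; ring.
    apply: (@le_trans _ _ (2 * K0 * K2 * N%:R `^ (2 - 2 / p))); last first.
      by rewrite ler_wpM2r ?powR_ge0.
    rewrite -[leRHS]mulrA ler_wpM2l ?mulr_ge0 ?(ltW K0_gt0)//.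
    by apply: le_trans BCN; rewrite ger0_norm ?addr_ge0 ?lerDl.
  have := ler_wpM2l (ltW K0_gt0) (card_A' N); rewrite mulrDr; lra.
split=> //.
- by move=> n [[/posA]|/hC []].
(* A single positive [N] satisfying the density bound shows that A' is non-empty. *)
- have [N [N0 NA']] : exists N : nat, 0 < N%:R :> R /\
      N%:R <= 2 * K0 * (card_trunc A' N)%:R :> R.
    near \oo => N; exists N; split; last by near: N; exact: dense.
    by rewrite ltr0n; near: N; exact: nbhs_infty_gt.
  apply/set0P/eqP => A'0; move: (lt_le_trans N0 NA').
  rewrite card_truncE big1 ?mulr0 ?ltxx// => n _.
  by rewrite /indic_weight /A' A'0 in_set0.
(* The factor 2^p comes from splitting the sum over A', [K1] from A, 1 + K2 from the perturbation,
   and (2 K0)^p from replacing [N] by A'(N). *)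
exists (2 `^ p * (K1 + 1 + K2) * (2 * K0) `^ p).
  by rewrite !mulr_gt0 ?powR_gt0 ?addr_gt0 ?mulr_gt0.
near=> N.
have N0 : 0 < N%:R :> R by rewrite ltr0n; near: N; exact: nbhs_infty_gt.
have N_neq0 : (N%:R == 0 :> R) = false by rewrite gt_eqF.
have NA' : N%:R <= 2 * K0 * (card_trunc A' N)%:R :> R by near: N; exact: dense.
have AN : `|mean_value p A N| <= K1 * (N%:R^-1 * (card_trunc A N)%:R `^ p).
  by near: N; exact: HA.
have BCN : `|(card_trunc B N)%:R + (card_trunc C N)%:R| <=
    K2 * N%:R `^ (2 - 2 / p) by near: N; exact: HBC.
have mv_ge0 D : 0 <= mean_value p D N.
  by apply: Rintegral_ge0 => x _; exact: powR_ge0.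
have sub_card D : (card_trunc D N)%:R <= N%:R :> R.
  rewrite card_truncE -[X in _ <= X%:R](size_iota 1) -sum1_size natr_sum.
  by apply: ler_sum => n _; rewrite ler_nat leq_b1.
rewrite ger0_norm// mean_valueE.
under eq_Rintegral do rewrite
  (_ : indic_weight R _ = fun n => iA n + (iC n - iB n)) ?(funext wA')//.
apply: (le_trans (Lp_trigsumD _ _ _ p02)); rewrite -mean_valueE.
have P_eq : N%:R^-1 * N%:R `^ p = N%:R `^ (p - 1) :> R.
  by rewrite powRB ?N_neq0 ?implybT// powRr1 ?ltW// mulrC.
have A_le : mean_value p A N <= K1 * N%:R `^ (p - 1).
  apply: (le_trans (ler_norm _)); apply: (le_trans AN).
  rewrite ler_wpM2l ?(ltW K1_gt0)// -P_eq ler_wpM2l ?invr_ge0//.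
  by rewrite ge0_ler_powR ?nnegrE ?(ltW p0).
(* This choice balances the splitting bound: both l^p and l^(p-2) N^(2-2/p) equal N^(p-1). *)
pose l : R := N%:R `^ (1 - 1 / p).
have BC_le : \int[mu]_(x in `[0, 1])
    (Normc.normc (trigsum (iota 1 N) (fun n => iC n - iB n) x) `^ p)
    <= (1 + K2) * N%:R `^ (p - 1).
  apply: (le_trans (Lp_trigsum_le _ (iota_uniq _ _) p02 (powR_gt0 _ N0 : 0 < l))).
  under eq_bigr do rewrite sqrBC.
  rewrite big_split /= -!card_truncE mulrDl mul1r.
  have -> : l `^ p = N%:R `^ (p - 1).
    by rewrite -powRrM; congr (_ `^ _); field.
  rewrite lerD2l; apply: (@le_trans _ _
    (l `^ (p - 2) * (K2 * N%:R `^ (2 - 2 / p)))).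
    by rewrite ler_wpM2l ?powR_ge0// (le_trans (ler_norm _)).
  rewrite mulrCA ler_wpM2l ?(ltW K2_gt0)// -powRrM -powRD ?N_neq0 ?implybT//.
  by rewrite (_ : (1 - 1 / p) * (p - 2) + (2 - 2 / p) = p - 1)//; field.
apply: (@le_trans _ _ (2 `^ p * (K1 + 1 + K2) * N%:R `^ (p - 1))).
  by rewrite -mulrA ler_wpM2l ?powR_ge0//; lra.
rewrite -[leRHS]mulrA ler_wpM2l ?mulr_ge0 ?powR_ge0//; first by lra.
(* N^(p-1) is rewritten as N^(-1) N^p, and the density bound is applied to the factor N^p only. *)
rewrite -P_eq mulrCA ler_wpM2l ?invr_ge0// -powRM ?mulr_ge0 ?(ltW K0_gt0)//.
by rewrite ge0_ler_powR ?nnegrE ?mulr_ge0 ?(ltW p0) ?(ltW K0_gt0).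
Unshelve. all: by end_near.
Qed.
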